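(* Let $$f(x)=\frac{1}{x}+\frac{\sin 2x}{2x^2}-2\cot x-\frac{8x^3}{45}+\frac{8x^5}{945}.$$ Let $c_0=c_1=c_2=0$ and, for $k\ge 3$, $$c_k=\frac{2^{2k+2}\left((4k+6)\,|B_{2k+2}|+(-1)^{k+1}\right)}{(2k+3)!}.$$ Then for every positive integer $m$ and every $x\in\left(0,\frac{\pi}{2}\right)$, $$\sum_{k=0}^{m}c_kx^{2k+1}<f(x)<\sum_{k=0}^{m-1}c_kx^{2k+1}+\left(f\!\left(\frac{\pi}{2}\right)-\sum_{k=0}^{m-1}c_k\left(\frac{\pi}{2}\right)^{2k+1}\right)\left(\frac{2x}{\pi}\right)^{2m+1}.$$
   Context: $B_i$ denotes the $i$-th Bernoulli number (so $B_2=\frac16$, $B_4=-\frac1{30}$, etc.). $f(\pi/2)$ is the value at $x=\pi/2$ of the formula defining $f$. *)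

(* Defs.v *)
From Stdlib Require Import Reals Arith Lra Lia.
Open Scope R_scope.

(* Course-of-values recursion: [bernoulli_table n] is the sequence of Bernoulli
   numbers, correct at all indices <= n.  [Binomial.C] is written qualified
   because Coquelicot also exports a [C] (the complex numbers). *)
Fixpoint bernoulli_table (n : nat) : nat -> R :=
  match n with
  | O => fun _ => 1
  | S p => fun i =>
      if (i <=? p)%nat then bernoulli_table p i
      else - / (INR p + 2) *
           sum_f_R0 (fun j => Binomial.C (p + 2) j * bernoulli_table p j) p
  end.

(* Convention x / (e^x - 1) = sum_n B_n x^n / n!, so B_1 = -1/2. *)
Definition bernoulli (n : nat) : R := bernoulli_table n n.

Lemma bernoulli_table_eq (n i : nat) :
  (i <= n)%nat -> bernoulli_table n i = bernoulli i.
Proof.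
  induction n as [|n IH]; intros Hi.
  - now replace i with 0%nat by lia.
  - destruct (Nat.eq_dec i (S n)) as [->|Hne]; [reflexivity|].
    simpl; rewrite (proj2 (Nat.leb_le i n)) by lia.
    apply IH; lia.
Qed.

Lemma bernoulli_0 : bernoulli 0 = 1.
Proof. reflexivity. Qed.

Lemma bernoulli_rec (n : nat) :
  (1 <= n)%nat -> sum_f_R0 (fun j => Binomial.C (n + 1) j * bernoulli j) n = 0.
Proof.
  destruct n as [|p]; intros Hn; [lia|].
  rewrite tech5.
  assert (HS : bernoulli (S p) = - / (INR p + 2) *
      sum_f_R0 (fun j => Binomial.C (S p + 1) j * bernoulli j) p).
  { unfold bernoulli at 1; cbn [bernoulli_table].
    rewrite (proj2 (Nat.leb_gt (S p) p)) by lia.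
    f_equal; apply sum_eq; intros j Hj.
    rewrite bernoulli_table_eq by lia.
    now replace (S p + 1)%nat with (p + 2)%nat by lia. }
  assert (HC : Binomial.C (S p + 1) (S p) = INR p + 2).
  { replace (S p + 1)%nat with (S (S p)) by lia.
    unfold Binomial.C.
    replace (S (S p) - S p)%nat with 1%nat by lia.
    change (fact (S (S p))) with (S (S p) * fact (S p))%nat.
    rewrite mult_INR, !S_INR; simpl (INR (fact 1)).
    pose proof (INR_fact_neq_0 (S p)).
    field; assumption. }
  rewrite HC, HS.
  pose proof (pos_INR p).
  field; lra.
Qed.

(* Used only for 0 < x <= PI / 2, where no denominator vanishes. *)
Definition f_cot (x : R) : R :=
  1 / x + sin (2 * x) / (2 * x ^ 2) - 2 * (cos x / sin x)
  - 8 * x ^ 3 / 45 + 8 * x ^ 5 / 945.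

Definition c_coef (k : nat) : R :=
  if (k <=? 2)%nat then 0
  else 2 ^ (2 * k + 2)
       * ((4 * INR k + 6) * Rabs (bernoulli (2 * k + 2)) + (-1) ^ (k + 1))
       / INR (fact (2 * k + 3)).

(* Main.v *)
Require Import Defs.
From Stdlib Require Import Reals Arith Lra Lia.
From Coquelicot Require Import Coquelicot.
Open Scope R_scope.

(** The numbers [c_coef k] are the Maclaurin coefficients of [f_cot] and are
    all nonnegative, those with [k >= 3] strictly positive; the two bounds then
    express only positivity.  For the lower one, the tail of the series beyond
    [m] is positive.  For the upper one, write [x = h * t] with [h = PI / 2] and
    [0 < t < 1]: the difference of the two sides is the sum over [k >= m] of
    [c_coef k * h ^ (2k+1) * (t ^ (2m+1) - t ^ (2k+1))], whose terms are
    nonnegative ([partial_sum_lt_series]).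

    What needs work is the expansion of the cotangent and its link with the
    Bernoulli numbers.  Write [x * cot x = 1 - x^2 * Q (x^2)].  The Riccati
    equation [cot' = - 1 - cot^2] becomes [3 Q + 2 y Q' = 1 + y Q^2], which
    determines the coefficients [cot_coef] of [Q] by a quadratic recurrence with
    positive terms.  So these numbers are defined by that recurrence, from which
    positivity, the geometric bound [cot_coef n <= (1/3) (1/6)^n] (hence
    convergence for [|y| < 6], and [(PI / 2)^2 < 6]) and a lower bound on their
    decay are immediate.

    For a real [s] and solutions of [Sn' = Cs], [Cs' = - s * Sn], [Sn 0 = 0], the
    Riccati equation gives [x * Cs x = (1 - s x^2 Q (s x^2)) * Sn x]
    ([cot_series_quotient]).  With [s = 1] this is the expansion of the cotangent.
    With [s = -1] it is that of the hyperbolic cotangent, thus of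
    [t / (e^t - 1) = (t/2) (coth (t/2) - 1)].  Comparing coefficients in
    [(t / (e^t - 1)) * ((e^t - 1) / t) = 1] yields the recurrence that defines the
    Bernoulli numbers, so that [|B_(2k+2)| = (2k+2)! * cot_coef k / 4^(k+1)]
    ([abs_bernoulli_even]).

    Finally [c_coef k = 2 * cot_coef k + (-1)^(k+1) 4^(k+1) / (2k+3)!] for
    [k >= 3].  It is positive since the factorial wins over the lower bound for
    [cot_coef] from [k = 4] on ([sin_coef_lt_cot_coef]), while at [k = 3] the sign
    is favourable. *)

(** * The coefficients of the cotangent and their Riccati equation *)

(** Course-of-values recursion: [cot_table n] agrees with the intended sequence
    at all indices up to [n], so the convolution may refer to it as a whole. *)
Fixpoint cot_table (n : nat) : nat -> R :=
  match n with
  | O => fun _ => / 3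
  | S p => fun i =>
      if (i <=? p)%nat then cot_table p i
      else PS_mult (cot_table p) (cot_table p) p / (2 * INR p + 5)
  end.

(** The coefficient of [x ^ (2n+2)] in [1 - x * cot x]. *)
Definition cot_coef (n : nat) : R := cot_table n n.

Lemma cot_table_eq (n i : nat) :
  (i <= n)%nat -> cot_table n i = cot_coef i.
Proof.
  induction n as [|n IH]; intros Hi.
  - now replace i with 0%nat by lia.
  - destruct (Nat.eq_dec i (S n)) as [->|Hne]; [reflexivity|].
    simpl; rewrite (proj2 (Nat.leb_le i n)) by lia.
    apply IH; lia.
Qed.

Lemma cot_coef_S (n : nat) :
  cot_coef (S n) = PS_mult cot_coef cot_coef n / (2 * INR n + 5).
Proof.
  unfold cot_coef at 1; cbn [cot_table].
  rewrite (proj2 (Nat.leb_gt (S n) n)) by lia.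
  f_equal; apply sum_eq; intros j Hj.
  rewrite !cot_table_eq by lia; reflexivity.
Qed.

(** The convolution has [n + 1] terms, each at most [(1/9) (1/6)^n] by induction,
    and [(n + 1) / (2n + 5) <= 1/2]: the ratio [1/6] reproduces itself. *)
Lemma cot_coef_bound (n : nat) : 0 < cot_coef n <= / 3 * (/ 6) ^ n.
Proof.
  induction n as [n IH] using (well_founded_induction Wf_nat.lt_wf).
  destruct n as [|n]; [unfold cot_coef; simpl; lra|].
  rewrite cot_coef_S; pose proof (pos_INR n) as Hn.
  assert (H : forall k, (k <= n)%nat ->
    0 < cot_coef k * cot_coef (n - k) <= / 9 * (/ 6) ^ n).
  { intros k Hk.
    destruct (IH k ltac:(lia)) as [H1 H2].
    destruct (IH (n - k)%nat ltac:(lia)) as [H3 H4].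
    split; [now apply Rmult_lt_0_compat|].
    replace ((/ 6) ^ n) with ((/ 6) ^ k * (/ 6) ^ (n - k))
      by (rewrite <- pow_add; f_equal; lia).
    replace (/ 9 * ((/ 6) ^ k * (/ 6) ^ (n - k)))
      with ((/ 3 * (/ 6) ^ k) * (/ 3 * (/ 6) ^ (n - k))) by field.
    apply Rmult_le_compat; lra. }
  assert (Hp : 0 < (/ 6) ^ n) by (apply pow_lt; lra).
  split.
  - apply Rdiv_lt_0_compat; [|lra].
    apply tech1; intros k Hk; apply H, Hk.
  - apply Rle_div_l; [lra|].
    apply Rle_trans with (sum_f_R0 (fun _ => / 9 * (/ 6) ^ n) n).
    + apply sum_Rle; intros k Hk; apply H, Hk.
    + rewrite sum_cte, S_INR; simpl ((/ 6) ^ S n); nra.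
Qed.

Lemma cot_coef_pos (n : nat) : 0 < cot_coef n.
Proof. apply cot_coef_bound. Qed.

Lemma CV_radius_ge_of_bounded (a : nat -> R) (r M : R) :
  (forall n, Rabs (a n * r ^ n) <= M) -> Rbar_le r (CV_radius a).
Proof.
  intros H; apply (proj1 (CV_radius_bounded a)); now exists M.
Qed.

Lemma CV_radius_cot_coef (y : R) : Rabs y < 6 -> Rbar_lt (Rabs y) (CV_radius cot_coef).
Proof.
  intros Hy; apply Rbar_lt_le_trans with (Finite 6); [exact Hy|].
  apply CV_radius_ge_of_bounded with 1; intros n.
  destruct (cot_coef_bound n) as [H1 H2].
  assert (H6 : 0 < 6 ^ n) by (apply pow_lt; lra).
  rewrite pow_inv in H2.
  rewrite Rabs_pos_eq by nra.
  apply Rmult_le_reg_r with (/ 6 ^ n); [now apply Rinv_0_lt_compat|].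
  rewrite Rmult_assoc, Rinv_r by lra.
  assert (0 < / 6 ^ n) by now apply Rinv_0_lt_compat.
  lra.
Qed.

(** The recurrence read as an identity between power series: the coefficient of
    [y ^ n] in [3 Q + 2 y Q'] is [(2n + 3) * cot_coef n]. *)
Lemma cot_series_riccati (y : R) : Rabs y < 6 ->
  3 * PSeries cot_coef y + 2 * y * PSeries (PS_derive cot_coef) y
  = 1 + y * PSeries cot_coef y ^ 2.
Proof.
  intros Hy; pose proof (CV_radius_cot_coef y Hy) as Hr.
  assert (Hd : Rbar_lt (Rabs y) (CV_radius (PS_derive cot_coef)))
    by now rewrite CV_radius_derive.
  apply CV_radius_inside in Hd; pose proof (CV_radius_inside _ _ Hr) as He.
  assert (Hd1 : ex_pseries (PS_incr_1 (PS_derive cot_coef)) y)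
    by now apply ex_pseries_incr_1.
  replace (3 * PSeries cot_coef y + 2 * y * PSeries (PS_derive cot_coef) y)
    with (PSeries (PS_plus (PS_scal 3 cot_coef)
                     (PS_scal 2 (PS_incr_1 (PS_derive cot_coef)))) y).
  2:{ rewrite PSeries_plus.
      - rewrite !PSeries_scal, PSeries_incr_1; ring.
      - apply ex_pseries_scal; [apply Rmult_comm | exact He].
      - apply ex_pseries_scal; [apply Rmult_comm | exact Hd1]. }
  rewrite PSeries_decr_1.
  2:{ apply ex_pseries_plus.
      - apply ex_pseries_scal; [apply Rmult_comm | exact He].
      - apply ex_pseries_scal; [apply Rmult_comm | exact Hd1]. }
  rewrite (PSeries_ext _ (PS_mult cot_coef cot_coef)).
  - rewrite PSeries_mult by assumption.
    unfold PS_plus, PS_scal, PS_incr_1, scal, plus, zero; simpl.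
    unfold mult, cot_coef; simpl; field.
  - intros n.
    unfold PS_decr_1, PS_plus, PS_scal, PS_incr_1, PS_derive, scal, plus; simpl.
    unfold mult; simpl. rewrite cot_coef_S. pose proof (pos_INR n).
    change (match n with O => 1 | S _ => INR n + 1 end) with (INR (S n)).
    rewrite S_INR; field; lra.
Qed.

(** By the Riccati equation, the defect
    [w = (1 - s x^2 Q (s x^2)) * Sn x - x * Cs x] satisfies the linear equation
    [w' = s x Q (s x^2) * w], and it vanishes at 0.  Since [F' = Q], the
    integrating factor is [exp (- F (s x^2) / 2)]. *)
Lemma cot_series_quotient (s : R) (Sn Cs : R -> R)
  (HS : forall x, is_derive Sn x (Cs x))
  (HC : forall x, is_derive Cs x (- s * Sn x))
  (HS0 : Sn 0 = 0) (x : R) :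
  Rabs (s * x ^ 2) < 6 ->
  (1 - s * x ^ 2 * PSeries cot_coef (s * x ^ 2)) * Sn x = x * Cs x.
Proof.
  intros Hx.
  set (Q := PSeries cot_coef); set (Q' := PSeries (PS_derive cot_coef)).
  set (F := PSeries (PS_Int cot_coef)).
  assert (HQ : forall y, Rabs y < 6 -> is_derive Q y (Q' y))
    by (intros y Hy; apply is_derive_PSeries, CV_radius_cot_coef, Hy).
  assert (HF : forall y, Rabs y < 6 -> is_derive F y (Q y)).
  { intros y Hy; unfold Q.
    rewrite (PSeries_ext cot_coef (PS_derive (PS_Int cot_coef))).
    - apply is_derive_PSeries; rewrite CV_radius_Int; apply CV_radius_cot_coef, Hy.
    - intros n; unfold PS_derive, PS_Int; field; apply not_0_INR; lia. }
  set (D := fun t => ((1 - s * t ^ 2 * Q (s * t ^ 2)) * Sn t - t * Cs t)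
                     * exp (- F (s * t ^ 2) / 2)).
  assert (HD : forall t, Rabs t <= Rabs x -> is_derive D t 0).
  { intros t Ht.
    assert (Hy : Rabs (s * t ^ 2) < 6).
    { apply Rle_lt_trans with (2 := Hx).
      rewrite !Rabs_mult, <- !RPow_abs.
      apply Rmult_le_compat_l; [apply Rabs_pos|].
      apply pow_incr; split; [apply Rabs_pos | exact Ht]. }
    pose proof (HQ _ Hy) as H1; pose proof (HF _ Hy) as H2.
    pose proof (HS t) as H3; pose proof (HC t) as H4.
    unfold D; auto_derive.
    - repeat split; eexists; eassumption.
    - replace (t * (t * 1)) with (t ^ 2) by ring.
      replace (Derive (fun x0 : R => Sn x0) t) with (Cs t)
        by (symmetry; now apply is_derive_unique).
      replace (Derive (fun x0 : R => Cs x0) t) with (- s * Sn t)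
        by (symmetry; now apply is_derive_unique).
      replace (Derive (fun x0 : R => Q x0) (s * t ^ 2)) with (Q' (s * t ^ 2))
        by (symmetry; now apply is_derive_unique).
      replace (Derive (fun x0 : R => F x0) (s * t ^ 2)) with (Q (s * t ^ 2))
        by (symmetry; now apply is_derive_unique).
      pose proof (cot_series_riccati _ Hy) as HR; fold Q Q' in HR.
      revert HR; generalize (Q (s * t ^ 2)) (Q' (s * t ^ 2))
        (exp (- F (s * t ^ 2) * / 2)); intros q q' e HR.
      (* The derivative is a multiple of the defect of the Riccati equation. *)
      transitivity (e * s * t * Sn t
        * (1 + s * t ^ 2 * q ^ 2 - (3 * q + 2 * (s * t ^ 2) * q'))).
      + field.
      + rewrite HR; ring. }
  assert (H0 : D x = D 0).
  { destruct (Rtotal_order x 0) as [Hlt | [-> | Hgt]]; [|reflexivity|].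
    - apply (eq_is_derive D x 0); [|exact Hlt].
      intros t Ht; apply HD; rewrite !Rabs_left1; lra.
    - symmetry; apply (eq_is_derive D 0 x); [|exact Hgt].
      intros t Ht; apply HD; rewrite !Rabs_pos_eq; lra. }
  unfold D in H0; rewrite HS0, Rmult_0_r, Rmult_0_l, Rminus_0_r, Rmult_0_l in H0.
  apply Rmult_integral in H0; destruct H0 as [H0 | H0]; [fold Q; lra|].
  exfalso; revert H0; apply Rgt_not_eq, exp_pos.
Qed.

(** * The Bernoulli numbers *)

(** The Maclaurin coefficients of
    [t / (e^t - 1) = 1 - t/2 + (t^2/4) * Q (- t^2/4)], that is, [B_n / n!]
    (see [bernoulli_egf_correct]). *)
Definition bernoulli_egf (n : nat) : R :=
  if Nat.even n then
    match Nat.div2 n with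
    | O => 1
    | S k => (-1) ^ k * cot_coef k / 4 ^ (k + 1)
    end
  else match n with 1%nat => - / 2 | _ => 0 end.

Lemma bernoulli_egf_even (k : nat) :
  bernoulli_egf (2 * S k) = (-1) ^ k * cot_coef k / 4 ^ (k + 1).
Proof.
  unfold bernoulli_egf.
  now rewrite Nat.even_even, Nat.div2_double.
Qed.

Lemma bernoulli_egf_odd (k : nat) : bernoulli_egf (2 * S k + 1) = 0.
Proof.
  unfold bernoulli_egf; rewrite Nat.even_odd.
  now replace (2 * S k + 1)%nat with (S (S (S (2 * k)))) by lia.
Qed.

Lemma bernoulli_egf_bound (n : nat) : Rabs (bernoulli_egf n) <= 1.
Proof.
  destruct (Nat.Even_or_Odd n) as [[[|k] ->] | [[|k] ->]].
  - unfold bernoulli_egf; simpl; rewrite Rabs_R1; lra.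
  - rewrite bernoulli_egf_even.
    unfold Rdiv; rewrite !Rabs_mult, pow_1_abs, Rmult_1_l.
    destruct (cot_coef_bound k) as [H1 H2].
    assert (H3 : (/ 6) ^ k <= 1)
      by (rewrite <- (pow1 k); apply pow_incr; lra).
    rewrite Rabs_inv, (Rabs_pos_eq (4 ^ _)), (Rabs_pos_eq (cot_coef k))
      by (try apply pow_le; lra).
    assert (1 <= 4 ^ (k + 1)) by (apply pow_R1_Rle; lra).
    assert (0 < / 4 ^ (k + 1) <= 1).
    { split; [apply Rinv_0_lt_compat; lra|].
      rewrite <- Rinv_1; apply Rinv_le_contravar; lra. }
    nra.
  - unfold bernoulli_egf; simpl; rewrite Rabs_Ropp, Rabs_pos_eq; lra.
  - rewrite bernoulli_egf_odd, Rabs_R0; lra.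
Qed.

(** Extensionality of series leaves equations in the carrier of [R_NormedModule];
    [ring] and [field] recognize them only at the type [R]. *)
Ltac in_R := match goal with |- @eq _ ?a ?b => change (@eq R a b) end.

Lemma is_series_zero : is_series (fun _ : nat => 0) 0.
Proof.
  apply is_series_Reals; intros e He; exists 0%nat; intros n _.
  rewrite sum_cte, Rmult_0_l. unfold Rdist; rewrite Rminus_0_r, Rabs_R0; exact He.
Qed.

Lemma is_series_cot_coef (y : R) :
  Rabs y < 6 -> is_series (fun n => cot_coef n * y ^ n) (PSeries cot_coef y).
Proof.
  intros Hy; apply is_pseries_R, PSeries_correct, CV_radius_inside.
  now apply CV_radius_cot_coef.
Qed.

Lemma is_pseries_bernoulli_egf (t : R) : Rabs t < 1 ->
  is_pseries bernoulli_egf t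
    (1 + t ^ 2 / 4 * PSeries cot_coef (- (t ^ 2 / 4)) + t * (- / 2)).
Proof.
  intros Ht.
  assert (Hy : Rabs (- (t ^ 2 / 4)) < 6).
  { rewrite Rabs_Ropp, Rabs_pos_eq by nra.
    apply Rabs_lt_between in Ht; nra. }
  apply is_pseries_odd_even; apply is_pseries_R; apply is_series_decr_1.
  - apply (is_series_ext
      (fun n => cot_coef n * (- (t ^ 2 / 4)) ^ n * (t ^ 2 / 4))).
    + intros n; rewrite bernoulli_egf_even.
      replace (- (t ^ 2 / 4)) with ((-1) * (t ^ 2 * / 4)) by field.
      rewrite !Rpow_mult_distr, pow_add, pow_inv, <- (tech_pow_Rmult (t ^ 2) n).
      in_R; field; apply pow_nonzero; lra.
    + replace (plus _ _) with (PSeries cot_coef (- (t ^ 2 / 4)) * (t ^ 2 / 4)).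
      * apply is_series_scal_r, is_series_cot_coef, Hy.
      * unfold plus, opp, bernoulli_egf; simpl; in_R; ring.
  - apply (is_series_ext (fun _ => 0)).
    + intros n; rewrite bernoulli_egf_odd; in_R; ring.
    + replace (plus _ _) with 0; [exact is_series_zero|].
      unfold plus, opp, bernoulli_egf; simpl; in_R; ring.
Qed.

(** With [t = 2 h], the hyperbolic case of [cot_series_quotient] gives
    [h * coth h], and [2 h / (e^(2h) - 1) = h * coth h - h]. *)
Lemma bernoulli_egf_mul_exp (t : R) : Rabs t < 1 ->
  PSeries bernoulli_egf t * (exp t - 1) = t.
Proof.
  intros Ht; rewrite (is_pseries_unique _ _ _ (is_pseries_bernoulli_egf t Ht)).
  set (h := t / 2).
  assert (Hs : Rabs (-1 * h ^ 2) < 6).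
  { replace (-1 * h ^ 2) with (- (t ^ 2 / 4)) by (unfold h; field).
    rewrite Rabs_Ropp, Rabs_pos_eq by nra.
    apply Rabs_lt_between in Ht; nra. }
  pose proof (cot_series_quotient (-1)
    (fun x => exp x - exp (- x)) (fun x => exp x + exp (- x))) as H.
  specialize (H ltac:(intros x; auto_derive; [trivial | ring])).
  specialize (H ltac:(intros x; auto_derive; [trivial | ring])).
  specialize (H ltac:(cbv beta; rewrite Ropp_0; ring) h Hs); cbv beta in H.
  replace (-1 * h ^ 2) with (- (t ^ 2 / 4)) in H by (unfold h; field).
  revert H; generalize (PSeries cot_coef (- (t ^ 2 / 4))); intros q H.
  replace t with (h + h) at 3 4 by (unfold h; field).
  replace (1 + t ^ 2 / 4 * q + t * - / 2) with (1 - - (t ^ 2 / 4) * q - h)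
    by (unfold h; field).
  rewrite exp_plus.
  assert (He : exp h * exp (- h) = 1)
    by (rewrite <- exp_plus, Rplus_opp_r; apply exp_0).
  replace (exp h * exp h - 1) with (exp h * (exp h - exp (- h)))
    by (rewrite Rmult_minus_distr_l, He; reflexivity).
  transitivity (exp h * (h * (exp h + exp (- h))) - h * (exp h * (exp h - exp (- h)))).
  - rewrite <- H; ring.
  - transitivity (2 * h * (exp h * exp (- h))); [ring | rewrite He; ring].
Qed.

(** The Maclaurin coefficients of [(e^t - 1) / t]. *)
Definition expm1_coef (n : nat) : R := / INR (fact (n + 1)).

Lemma inv_fact_bound (n : nat) : 0 < / INR (fact n) <= 1.
Proof.
  assert (1 <= INR (fact n)) by (apply (le_INR 1), lt_O_fact).
  split; [apply Rinv_0_lt_compat; lra|].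
  rewrite <- Rinv_1; apply Rinv_le_contravar; lra.
Qed.

Lemma exp_sub_1_series (t : R) : exp t - 1 = t * PSeries expm1_coef t.
Proof.
  rewrite <- (is_pseries_unique _ _ _ (is_exp_Reals t)), PSeries_decr_1
    by (exists (exp t); apply is_exp_Reals).
  rewrite (PSeries_ext _ expm1_coef).
  - simpl; field.
  - intros n; unfold PS_decr_1, expm1_coef; now rewrite Nat.add_1_r.
Qed.

Lemma lt_CV_radius_of_bounded_by_1 (a : nat -> R) (t : R) :
  (forall n, Rabs (a n) <= 1) -> Rabs t < 1 -> Rbar_lt (Rabs t) (CV_radius a).
Proof.
  intros Ha Ht; apply Rbar_lt_le_trans with (Finite 1); [exact Ht|].
  apply CV_radius_ge_of_bounded with 1; intros n.
  rewrite pow1, Rmult_1_r; apply Ha.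
Qed.

(** Uniqueness of the coefficients in [(t / (e^t - 1)) * ((e^t - 1) / t) = 1]. *)
Lemma bernoulli_egf_conv (n : nat) :
  PS_mult bernoulli_egf expm1_coef n = if (n =? 0)%nat then 1 else 0.
Proof.
  assert (HE : forall k, Rabs (expm1_coef k) <= 1).
  { intros k; unfold expm1_coef; pose proof (inv_fact_bound (k + 1)).
    rewrite Rabs_pos_eq; lra. }
  pose proof (fun t H => lt_CV_radius_of_bounded_by_1 _ t HE H) as RE.
  pose proof (fun t H => lt_CV_radius_of_bounded_by_1 _ t bernoulli_egf_bound H) as RB.
  apply (PSeries_ext_recip (PS_mult bernoulli_egf expm1_coef)
    (fun n => if (n =? 0)%nat then 1 else 0)).
  (* The product converges at 1/2, so its radius cannot vanish. *)
  - destruct (Rbar_lt_le_dec 0 (CV_radius (PS_mult bernoulli_egf expm1_coef)))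
      as [H | H]; [exact H | exfalso].
    apply (CV_disk_outside (PS_mult bernoulli_egf expm1_coef) (/ 2)).
    + apply Rbar_le_lt_trans with (1 := H); simpl; rewrite Rabs_pos_eq; lra.
    + apply ex_series_lim_0, ex_pseries_R, ex_pseries_mult; [apply RB | apply RE];
      rewrite Rabs_pos_eq; lra.
  - apply Rbar_lt_le_trans with (Finite 1); [exact Rlt_0_1|].
    apply CV_radius_ge_of_bounded with 1; intros [|k]; rewrite pow1, Rmult_1_r; simpl;
      [rewrite Rabs_R1 | rewrite Rabs_R0]; lra.
  - exists (mkposreal 1 Rlt_0_1); intros t Ht.
    assert (Ht' : Rabs t < 1).
    { revert Ht; unfold ball; simpl; unfold AbsRing_ball, abs, minus, plus, opp; simpl.
      now rewrite Ropp_0, Rplus_0_r. }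
    rewrite PSeries_mult by auto.
    transitivity 1.
    + destruct (Req_dec t 0) as [-> | Hne].
      * rewrite !PSeries_0; unfold bernoulli_egf, expm1_coef; simpl; field.
      * apply Rmult_eq_reg_l with t; [|exact Hne].
        pose proof (bernoulli_egf_mul_exp t Ht') as H.
        rewrite exp_sub_1_series in H; lra.
    + symmetry; apply is_pseries_unique, is_pseries_R, is_series_decr_1.
      apply (is_series_ext (fun _ => 0)); [intros k; simpl; in_R; ring|].
      replace (plus _ _) with 0; [exact is_series_zero|].
      unfold plus, opp; simpl; in_R; ring.
Qed.

(** Multiplied by [(n + 1)!], the convolution identity becomes the recurrence
    [bernoulli_rec], in which the last term determines [bernoulli n]. *)
Lemma bernoulli_egf_correct (n : nat) :
  bernoulli n = INR (fact n) * bernoulli_egf n.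
Proof.
  induction n as [n IH] using (well_founded_induction Wf_nat.lt_wf).
  destruct n as [|p]; [unfold bernoulli_egf; rewrite bernoulli_0; simpl; ring|].
  pose proof (bernoulli_rec (S p) ltac:(lia)) as H1.
  pose proof (bernoulli_egf_conv (S p)) as H2.
  change (S p =? 0)%nat with false in H2; cbv iota in H2.
  unfold PS_mult in H2.
  assert (HC : forall j, (j <= S p)%nat -> Binomial.C (S p + 1) j
     = INR (fact (S p + 1)) * (/ INR (fact j) * expm1_coef (S p - j))).
  { intros j Hj; unfold Binomial.C, expm1_coef.
    replace (S p - j + 1)%nat with (S p + 1 - j)%nat by lia.
    field; split; apply INR_fact_neq_0. }
  assert (H3 : sum_f_R0 (fun j => Binomial.C (S p + 1) j
     * (INR (fact j) * bernoulli_egf j)) (S p) = 0).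
  { rewrite <- (Rmult_0_r (INR (fact (S p + 1)))), <- H2, scal_sum.
    apply sum_eq; intros j Hj; rewrite HC by exact Hj.
    field; apply INR_fact_neq_0. }
  rewrite tech5 in H1, H3.
  rewrite (sum_eq _ (fun j => Binomial.C (S p + 1) j
     * (INR (fact j) * bernoulli_egf j))) in H1
    by (intros j Hj; rewrite (IH j) by lia; reflexivity).
  apply Rmult_eq_reg_l with (Binomial.C (S p + 1) (S p)); [lra|].
  rewrite HC by lia; unfold expm1_coef.
  repeat apply Rmult_integral_contrapositive_currified;
    try apply Rinv_neq_0_compat; apply INR_fact_neq_0.
Qed.

Lemma abs_bernoulli_even (k : nat) :
  Rabs (bernoulli (2 * k + 2)) = INR (fact (2 * k + 2)) * cot_coef k / 4 ^ (k + 1).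
Proof.
  rewrite bernoulli_egf_correct.
  replace (2 * k + 2)%nat with (2 * S k)%nat at 2 by lia.
  rewrite bernoulli_egf_even; unfold Rdiv; rewrite !Rabs_mult, pow_1_abs.
  assert (0 < 4 ^ (k + 1)) by (apply pow_lt; lra).
  rewrite Rabs_inv, (Rabs_pos_eq (4 ^ _)), (Rabs_pos_eq (cot_coef k)),
    (Rabs_pos_eq (INR _)); try lra.
  - apply pos_INR.
  - apply Rlt_le, cot_coef_pos.
Qed.

(** * The Maclaurin series of the function *)

(** Coefficient of [x ^ (2k+1)] in
    [1 / x + sin (2 x) / (2 x^2) - 2 cot x]: the polynomial terms of [f_cot]
    cancel the nonzero ones among those of index [k <= 2], and [c_coef] is 0
    there. *)
Definition maclaurin_coef (k : nat) : R :=
  2 * cot_coef k + (-1) ^ (k + 1) * 4 ^ (k + 1) / INR (fact (2 * k + 3)).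

Lemma c_coef_eq (k : nat) : (3 <= k)%nat -> c_coef k = maclaurin_coef k.
Proof.
  intros Hk; unfold c_coef, maclaurin_coef.
  rewrite (proj2 (Nat.leb_gt k 2)) by lia.
  rewrite abs_bernoulli_even.
  replace (2 * k + 2)%nat with (2 * (k + 1))%nat at 1 by lia.
  rewrite pow_mult; replace (2 ^ 2) with 4 by ring.
  replace (2 * k + 3)%nat with (S (2 * k + 2)) by lia.
  rewrite fact_simpl, mult_INR, S_INR, plus_INR, mult_INR; simpl (INR 2).
  pose proof (pos_INR k); pose proof (INR_fact_neq_0 (2 * k + 2)).
  assert (4 ^ (k + 1) <> 0) by (apply pow_nonzero; lra).
  field; repeat split; lra.
Qed.

Lemma cot_coef_0 : cot_coef 0 = / 3.
Proof. reflexivity. Qed.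

Lemma cot_coef_1 : cot_coef 1 = / 45.
Proof. rewrite cot_coef_S; unfold PS_mult; simpl; rewrite !cot_coef_0; field. Qed.

Lemma cot_coef_2 : cot_coef 2 = 2 / 945.
Proof. rewrite cot_coef_S; unfold PS_mult; simpl; rewrite !cot_coef_0, !cot_coef_1; field. Qed.

Lemma cot_coef_3 : cot_coef 3 = / 4725.
Proof.
  rewrite cot_coef_S; unfold PS_mult; simpl.
  rewrite !cot_coef_0, !cot_coef_1, !cot_coef_2; field.
Qed.

Lemma cot_coef_4 : cot_coef 4 = 2 / 93555.
Proof.
  rewrite cot_coef_S; unfold PS_mult; simpl.
  rewrite !cot_coef_0, !cot_coef_1, !cot_coef_2, !cot_coef_3; field.
Qed.

(** Keeping only the last term [cot_coef k * cot_coef 0] of the recurrence. *)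
Lemma cot_coef_growth (k : nat) :
  cot_coef k <= 3 * (2 * INR k + 5) * cot_coef (S k).
Proof.
  rewrite cot_coef_S; pose proof (pos_INR k).
  replace (3 * (2 * INR k + 5) * _) with (3 * PS_mult cot_coef cot_coef k)
    by (field; lra).
  unfold PS_mult; destruct k as [|k]; [simpl; rewrite cot_coef_0; lra|].
  rewrite tech5, Nat.sub_diag, cot_coef_0.
  assert (0 < sum_f_R0 (fun i => cot_coef i * cot_coef (S k - i)) k); [|lra].
  apply tech1; intros i _; apply Rmult_lt_0_compat; apply cot_coef_pos.
Qed.

(** From [k] to [k + 1] the right side grows at least by the factor
    [(2k + 4) / 3], which is at least 4 for [k >= 4]; the base case is the
    numerical fact [1024 < 4 * 11! / 93555]. *)
Lemma sin_coef_lt_cot_coef (k : nat) : (4 <= k)%nat ->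
  4 ^ (k + 1) < 2 * cot_coef k * INR (fact (2 * k + 3)).
Proof.
  induction 1 as [|k Hk IH].
  - change (2 * 4 + 3)%nat with 11%nat; rewrite cot_coef_4.
    rewrite !fact_simpl, !mult_INR; simpl; lra.
  - replace (S k + 1)%nat with (S (k + 1)) by lia.
    replace (2 * S k + 3)%nat with (S (S (2 * k + 3))) by lia.
    rewrite (fact_simpl (S _)), (fact_simpl (2 * k + 3)), !mult_INR, <- tech_pow_Rmult.
    pose proof (cot_coef_growth k) as Hg.
    pose proof (lt_0_INR _ (lt_O_fact (2 * k + 3))) as HF.
    apply le_INR in Hk; simpl (INR 4) in Hk.
    rewrite !S_INR, plus_INR, mult_INR; simpl (INR 2); simpl (INR 3).
    set (F := INR (fact (2 * k + 3))) in *.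
    replace (2 * cot_coef (S k) * ((2 * INR k + 3 + 1 + 1) * ((2 * INR k + 3 + 1) * F)))
      with ((2 * INR k + 4) * (/ 3 * (2 * F * (3 * (2 * INR k + 5) * cot_coef (S k)))))
      by field.
    assert (4 ^ (k + 1) < 2 * F * (3 * (2 * INR k + 5) * cot_coef (S k))) by nra.
    assert (0 < 4 ^ (k + 1)) by (apply pow_lt; lra).
    nra.
Qed.

Lemma c_coef_pos (k : nat) : (3 <= k)%nat -> 0 < c_coef k.
Proof.
  intros Hk; rewrite c_coef_eq by exact Hk; unfold maclaurin_coef.
  pose proof (cot_coef_pos k) as Hq.
  pose proof (lt_0_INR _ (lt_O_fact (2 * k + 3))) as HF.
  assert (H4 : 0 < 4 ^ (k + 1)) by (apply pow_lt; lra).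
  destruct (Nat.eq_dec k 3) as [-> | Hne].
  (* Here the sine contributes with a positive sign. *)
  - change ((-1) ^ (3 + 1)) with ((-1) * ((-1) * ((-1) * ((-1) * 1)))).
    assert (0 < 4 ^ (3 + 1) / INR (fact (2 * 3 + 3))) by now apply Rdiv_lt_0_compat.
    lra.
  - pose proof (sin_coef_lt_cot_coef k ltac:(lia)) as H.
    assert (4 ^ (k + 1) / INR (fact (2 * k + 3)) < 2 * cot_coef k)
      by now apply Rlt_div_l.
    assert (0 < 4 ^ (k + 1) / INR (fact (2 * k + 3))) by now apply Rdiv_lt_0_compat.
    pose proof (pow_1_abs (k + 1)) as Hsgn.
    pose proof (Rle_abs (- (-1) ^ (k + 1))) as Hge.
    rewrite Rabs_Ropp, Hsgn in Hge.
    unfold Rdiv in *; nra.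
Qed.

Lemma is_series_maclaurin (x : R) : x <> 0 -> sin x <> 0 -> x ^ 2 < 6 ->
  is_series (fun k => maclaurin_coef k * x ^ (2 * k + 1))
    (1 / x + sin (2 * x) / (2 * x ^ 2) - 2 * (cos x / sin x)).
Proof.
  intros Hx Hs H6.
  assert (HQ : Rabs (x ^ 2) < 6) by (rewrite Rabs_pos_eq; nra).
  pose proof (cot_series_quotient 1 sin cos) as Hcot.
  specialize (Hcot is_derive_sin).
  specialize (Hcot ltac:(intros t; auto_derive; [trivial | ring]) sin_0 x).
  rewrite !Rmult_1_l in Hcot; specialize (Hcot HQ).
  destruct (exist_sin (Rsqr (2 * x))) as [u Hu] eqn:E.
  assert (Hsin : sin (2 * x) = 2 * x * u) by (unfold sin; rewrite E; reflexivity).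
  pose proof (proj2 (is_series_Reals _ _) Hu) as Hu'.
  replace (1 / x + sin (2 * x) / (2 * x ^ 2) - 2 * (cos x / sin x))
    with (PSeries cot_coef (x ^ 2) * (2 * x) + (u - 1) * / x).
  2:{ rewrite Hsin; replace (cos x) with (x * cos x * / x) by (field; exact Hx).
      rewrite <- Hcot; field; auto. }
  apply (is_series_ext (fun k => plus (cot_coef k * (x ^ 2) ^ k * (2 * x))
    (sin_n (k + 1) * (Rsqr (2 * x)) ^ (k + 1) * / x))).
  - intros k.
    match goal with |- plus ?a ?b = ?c => change (a + b = c) end.
    unfold maclaurin_coef, sin_n.
    replace (2 * (k + 1) + 1)%nat with (2 * k + 3)%nat by lia.
    replace (Rsqr (2 * x)) with (4 * x ^ 2) by (unfold Rsqr; ring).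
    rewrite Rpow_mult_distr, <- !pow_mult, Nat.mul_add_distr_l, !pow_add.
    change (2 * 1)%nat with 2%nat; field; split; [apply INR_fact_neq_0 | exact Hx].
  - apply (is_series_plus (V := R_NormedModule)); apply is_series_scal_r.
    + apply is_series_cot_coef, HQ.
    + apply (is_series_ext (fun k => sin_n (S k) * (Rsqr (2 * x)) ^ (S k))).
      * intros k; rewrite Nat.add_1_r; reflexivity.
      * apply (is_series_incr_1 (fun k => sin_n k * (Rsqr (2 * x)) ^ k)).
        replace (plus _ _) with u; [exact Hu'|].
        unfold plus, sin_n; simpl; in_R; field.
Qed.

(** The endpoint [PI / 2] is included, as the upper bound evaluates [f_cot] there. *)
Lemma is_series_f_cot (x : R) : 0 < x <= PI / 2 ->
  is_series (fun k => c_coef k * x ^ (2 * k + 1)) (f_cot x).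
Proof.
  intros Hx; pose proof PI_4 as HPI; pose proof PI_RGT_0.
  assert (Hs : sin x <> 0) by (apply Rgt_not_eq, sin_gt_0; lra).
  pose proof (is_series_maclaurin x ltac:(lra) Hs ltac:(nra)) as H1.
  apply (is_series_decr_n _ 3); [lia|].
  apply (is_series_ext (fun k => maclaurin_coef (3 + k) * x ^ (2 * (3 + k) + 1))).
  - intros k; rewrite c_coef_eq by lia; reflexivity.
  - apply (is_series_incr_n (fun k => maclaurin_coef k * x ^ (2 * k + 1))); [lia|].
    replace (plus _ _) with (1 / x + sin (2 * x) / (2 * x ^ 2) - 2 * (cos x / sin x)).
    + exact H1.
    + rewrite !sum_n_Reals; unfold f_cot, plus, opp, maclaurin_coef, c_coef; simpl.
      rewrite cot_coef_0, cot_coef_1, cot_coef_2; in_R; field; lra.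
Qed.

(** * The two inequalities *)

Lemma partial_sum_lt_series (a : nat -> R) (l : R) (n p : nat) :
  is_series a l -> (n < p)%nat -> 0 < a p ->
  (forall k, (n < k)%nat -> 0 <= a k) ->
  sum_f_R0 a n < l.
Proof.
  intros Hl Hnp Hp Ha.
  assert (Hmono : forall d, sum_f_R0 a n <= sum_f_R0 a (n + d)).
  { induction d as [|d IH]; [rewrite Nat.add_0_r; lra|].
    rewrite Nat.add_succ_r, tech5; pose proof (Ha (S (n + d)) ltac:(lia)); lra. }
  assert (Hp' : sum_f_R0 a n < sum_f_R0 a p).
  { destruct p as [|p]; [lia|].
    rewrite tech5; pose proof (Hmono (p - n)%nat) as H.
    replace (n + (p - n))%nat with p in H by lia; lra. }
  apply Rlt_le_trans with (1 := Hp').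
  assert (Hlim : is_lim_seq (fun d => sum_f_R0 a (d + p)) l).
  { apply (is_lim_seq_incr_n (fun d => sum_f_R0 a d) p).
    apply (is_lim_seq_ext (sum_n a)); [apply sum_n_Reals | exact Hl]. }
  apply (is_lim_seq_incr_compare _ _ Hlim) with (n := 0%nat).
  intros d; simpl; pose proof (Ha (S (d + p)) ltac:(lia)); lra.
Qed.

Theorem theorem4 :
  forall (m : nat) (x : R),
    (1 <= m)%nat -> 0 < x < PI / 2 ->
    sum_f_R0 (fun k => c_coef k * x ^ (2 * k + 1)) m < f_cot x /\
    f_cot x <
      sum_f_R0 (fun k => c_coef k * x ^ (2 * k + 1)) (m - 1)
      + (f_cot (PI / 2)
         - sum_f_R0 (fun k => c_coef k * (PI / 2) ^ (2 * k + 1)) (m - 1))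
        * (2 * x / PI) ^ (2 * m + 1).
Proof.
  intros m x Hm Hx.
  assert (Hc : forall k, 0 <= c_coef k).
  { intros k; destruct (le_lt_dec 3 k) as [H | H].
    - now apply Rlt_le, c_coef_pos.
    - unfold c_coef; rewrite (proj2 (Nat.leb_le k 2)) by lia; lra. }
  pose proof (is_series_f_cot x ltac:(lra)) as Hser.
  split.
  - apply (partial_sum_lt_series _ _ m (m + 3) Hser); [lia | |].
    + apply Rmult_lt_0_compat; [apply c_coef_pos; lia | apply pow_lt; lra].
    + intros k _; apply Rmult_le_pos; [apply Hc | apply pow_le; lra].
  - set (h := PI / 2) in *; set (t := 2 * x / PI).
    assert (Hh : 0 < h) by lra.
    assert (Hxt : x = h * t).
    { unfold h, t; field; apply Rgt_not_eq, PI_RGT_0. }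
    assert (Ht : 0 < t < 1) by nra.
    pose proof (is_series_f_cot h ltac:(unfold h in *; lra)) as Hserh.
    (* For [k < m] the terms of [e] are at most 0: they make up exactly the
       partial sum to which the total is compared. *)
    set (e := fun k => c_coef k * h ^ (2 * k + 1) * (t ^ (2 * m + 1) - t ^ (2 * k + 1))).
    assert (He : is_series e (f_cot h * t ^ (2 * m + 1) - f_cot x)).
    { apply (is_series_ext (fun k => plus (c_coef k * h ^ (2 * k + 1) * t ^ (2 * m + 1))
         (opp (c_coef k * x ^ (2 * k + 1))))).
      - intros k; unfold e; rewrite Hxt, Rpow_mult_distr.
        match goal with |- plus ?a (opp ?b) = ?c => change (a + - b = c) end; ring.
      - apply (is_series_minus (V := R_NormedModule)); [|exact Hser].
        apply is_series_scal_r, Hserh. }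
    assert (Hpow : forall k, (m < k)%nat -> t ^ (2 * k + 1) < t ^ (2 * m + 1)).
    { intros k Hk; replace (2 * k + 1)%nat with (2 * m + 1 + 2 * (k - m))%nat by lia.
      rewrite pow_add; rewrite <- (Rmult_1_r (t ^ (2 * m + 1))) at 2.
      apply Rmult_lt_compat_l; [apply pow_lt; lra|].
      apply pow_lt_1_compat; [lra | lia]. }
    assert (Hlt : sum_f_R0 e (m - 1) < f_cot h * t ^ (2 * m + 1) - f_cot x).
    { apply (partial_sum_lt_series _ _ _ (m + 3) He); [lia | |].
      - unfold e; repeat apply Rmult_lt_0_compat.
        + apply c_coef_pos; lia.
        + apply pow_lt, Hh.
        + pose proof (Hpow (m + 3)%nat ltac:(lia)); lra.
      - intros k Hk; unfold e; repeat apply Rmult_le_pos.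
        + apply Hc.
        + apply pow_le; lra.
        + destruct (Nat.eq_dec k m) as [-> | Hne]; [lra|].
          pose proof (Hpow k ltac:(lia)); lra. }
    replace (sum_f_R0 e (m - 1)) with
      (sum_f_R0 (fun k => c_coef k * h ^ (2 * k + 1)) (m - 1) * t ^ (2 * m + 1)
       - sum_f_R0 (fun k => c_coef k * x ^ (2 * k + 1)) (m - 1)) in Hlt; [lra|].
    rewrite (Rmult_comm (sum_f_R0 _ _)), scal_sum, <- minus_sum.
    apply sum_eq; intros k _; unfold e; rewrite Hxt, Rpow_mult_distr; ring.
Qed.
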